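(* For every even positive integer $n$, $$R_n\le 2\sqrt{\frac{80}{n-1}}<\frac{18}{\sqrt{n-1}} .$$
   Context: Let $[n]=\{1,\dots,n\}$, $\mathscr M_n$ the set of perfect matchings of $[n]$ (sets of $n/2$ disjoint pairs covering $[n]$), $\mathcal F_n=\{S\subseteq[n]:|S|\neq0,2\}$. For $g:\{\pm1\}^n\to\mathbb R$ let $\widehat g(S)=2^{-n}\sum_{\varepsilon\in\{\pm1\}^n}g(\varepsilon)\prod_{i\in S}\varepsilon_i$. Let $\mathcal K_n$ be the set of $g:\{\pm1\}^n\to\mathbb R$ with $g\ge0$ pointwise, $\widehat g(\emptyset)=1$, and $\widehat g(S)=0$ for all $S\in\mathcal F_n$. For $g\in\mathcal K_n$ let $\Phi(g)=\mathbb E_{\mathtt M}\big[\max_{e\in\mathtt M}|\widehat g(e)|\big]$ with $\mathtt M$ uniform on $\mathscr M_n$, and $R_n=\max_{g\in\mathcal K_n}\Phi(g)$. *)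

(* Defs.v *)
From mathcomp Require Import all_boot all_order all_algebra.
From mathcomp Require Import all_classical all_reals all_analysis.

Set Implicit Arguments.
Unset Strict Implicit.
Unset Printing Implicit Defensive.

Import Order.TTheory GRing.Theory Num.Theory.
Import numFieldNormedType.Exports.

Local Open Scope classical_set_scope.
Local Open Scope ring_scope.

(* The ground set {1, ..., n} is 'I_n, and {+1, -1}^n is encoded by boolean
   vectors, b standing for the sign (-1) ^+ b. *)
Definition cube (n : nat) := {ffun 'I_n -> bool}.

Definition chi (R : realType) (n : nat) (S : {set 'I_n}) (x : cube n) : R :=
  \prod_(i in S) (-1) ^+ x i.

Definition fourier (R : realType) (n : nat) (g : cube n -> R) (S : {set 'I_n})
    : R :=
  2 ^- n * \sum_(x : cube n) g x * chi R S x.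

Definition perfect_matchings (n : nat) : {set {set {set 'I_n}}} :=
  [set M : {set {set 'I_n}} |
     finset.partition M finset.setT &
     [forall e in M, #|e : {set 'I_n}| == 2%N]]%SET.

Definition Fset (n : nat) : {set {set 'I_n}} :=
  [set S : {set 'I_n} | (#|S| != 0%N) && (#|S| != 2%N)]%SET.

Definition Kset (R : realType) (n : nat) : set (cube n -> R) :=
  [set g | [/\ forall x, 0 <= g x,
               fourier g finset.set0 = 1
             & forall S, S \in Fset n -> fourier g S = 0]].
Arguments Kset : clear implicits.

(* The default value 0 of the maximum is harmless: the entries are absolute
   values, and a perfect matching is nonempty when n > 0. *)
Definition Phi (R : realType) (n : nat) (g : cube n -> R) : R :=
  (\sum_(M in perfect_matchings n)
      \big[Num.max/0]_(e in M) `|fourier g e|) / #|perfect_matchings n|%:R.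

(* This supremum is a maximum: see Rmax_attained and Phi_le_Rmax below. *)
Definition Rmax (R : realType) (n : nat) : R := sup (@Phi R n @` Kset R n).

Lemma sum_chi (R : realType) (n : nat) (S : {set 'I_n}) :
  \sum_(x : cube n) chi R S x = if S == finset.set0 then 2 ^+ n else 0.
Proof.
transitivity (\prod_(i < n) \sum_(b : bool)
                (if i \in S then (-1) ^+ b else 1 : R)).
  by rewrite bigA_distr_bigA /=; apply: eq_bigr => x _; rewrite /chi big_mkcond.
have [->|/set0Pn[i iS]] := eqVneq S finset.set0.
  rewrite (eq_bigr (fun=> 2)) ?prodr_const ?card_ord// => i _.
  by rewrite big_bool /= inE -mulr2n.
by rewrite (bigD1 i)//= iS big_bool /= expr1 expr0 addNr mul0r.
Qed.

Lemma Kset_nonempty (R : realType) (n : nat) : Kset R n !=set0.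
Proof.
exists (fun=> 1); split=> [x|//|S]; rewrite /fourier.
- exact: ler01.
- under eq_bigr do rewrite mul1r.
  by rewrite sum_chi eqxx mulVf// expf_neq0.
- rewrite inE => /andP[S0 _].
  under eq_bigr do rewrite mul1r.
  by rewrite sum_chi -cards_eq0 (negbTE S0) mulr0.
Qed.

Lemma Kset_le (R : realType) (n : nat) (g : cube n -> R) (x : cube n) :
  Kset R n g -> g x <= 2 ^+ n.
Proof.
move=> [g0 g1 _].
have -> : 2 ^+ n = \sum_y g y.
  apply: (mulfI (_ : 2 ^- n != 0 :> R)); first by rewrite invr_eq0 expf_neq0.
  rewrite mulVf ?expf_neq0// -[LHS]g1 /fourier; congr (_ * _).
  by under eq_bigr do rewrite /chi big_set0 mulr1.
by rewrite (bigD1 x)//= lerDl sumr_ge0.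
Qed.

Section attained.
Context (R : realType) (n : nat).
Let T := prod_topology (fun _ : cube n => R : topologicalType).

Let continuous_ev (x : cube n) : continuous (fun g : T => (g x : R)).
Proof. exact: (@proj_continuous _ (fun=> R : topologicalType) x). Qed.

Let continuous_fourier (S : {set 'I_n}) :
  continuous (fun g : T => fourier (g : cube n -> R) S).
Proof.
have cs : continuous (fun g : T => \sum_(x : cube n) (g x : R) * chi R S x).
  apply: (@continuous_big R _ +%R 0 xpredT (@add_continuous R) T) => x _ g.
  exact: (@cvgMr_tmp R T (nbhs g) _ (fun h : T => h x : R) _ _
            (@continuous_ev x g)).
by move=> g; exact: (@cvgMl_tmp R T (nbhs g) _ _ (2 ^- n) _ (cs g)).
Qed.

Let max_continuous : continuous (fun x : R * R => Num.max x.1 x.2).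
Proof.
by move=> x; apply: (@continuous_max R _ fst snd);
  [exact: cvg_fst|exact: cvg_snd].
Qed.

Let continuous_Phi : continuous (fun g : T => Phi (g : cube n -> R)).
Proof.
have cs : continuous (fun g : T => \sum_(M in perfect_matchings n)
    \big[Num.max/0]_(e in M) `|fourier (g : cube n -> R) e|).
  apply: (@continuous_big R _ +%R 0 _ (@add_continuous R) T) => M _.
  apply: (@continuous_big R _ Num.max 0 _ max_continuous T) => e _ g.
  exact: (@cvg_norm R R T (nbhs g) _ _ _ (@continuous_fourier e g)).
by move=> g; exact: (@cvgMr_tmp R T (nbhs g) _ _ _ _ (cs g)).
Qed.

Let compact_Kset : compact (Kset R n : set T).
Proof.
pose box : set T := [set g | forall x, `[0, 2 ^+ n]%classic (g x : R)].
apply: (@subclosed_compact _ _ box).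
- have -> : (Kset R n : set T) =
      \bigcap_(x in [set: cube n]) ((fun g : T => g x : R) @^-1` [set r | 0 <= r])
      `&` ((fun g : T => fourier (g : cube n -> R) finset.set0) @^-1` [set 1]
      `&` \bigcap_(S in [set S | S \in Fset n])
          ((fun g : T => fourier (g : cube n -> R) S) @^-1` [set 0])).
    apply/seteqP; split=> [g [g0 g1 gS]|g [g0 [g1 gS]]].
      by split=> [x _|]; [exact: g0|split].
    by split=> // x; exact: g0.
  apply: closedI; last apply: closedI.
  + apply: closed_bigI => x _.
    by apply: preimage_closed => [g _|]; [exact: continuous_ev|exact: closed_ge].
  + apply: preimage_closed => [g _|]; last exact: closed_eq.
    exact: continuous_fourier.
  + apply: closed_bigI => S _.
    apply: preimage_closed => [g _|]; last exact: closed_eq.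
    exact: continuous_fourier.
- apply: (@tychonoff _ (fun=> R : topologicalType)
            (fun=> `[0, 2 ^+ n]%classic)) => x.
  exact: segment_compact.
- move=> g Kg x; rewrite /= in_itv /= (Kset_le x Kg) andbT.
  by case: Kg.
Qed.

Let Phi_max : exists2 g, Kset R n g &
  forall h, Kset R n h -> Phi h <= Phi g :> R.
Proof.
have [g] := @compact_EVT_max T R (fun g => Phi (g : cube n -> R)) (Kset R n)
  (Kset_nonempty R n) compact_Kset (continuous_subspaceT continuous_Phi).
rewrite inE => Kg gmax; exists g => // h Kh.
by apply: gmax; rewrite inE.
Qed.

Lemma Phi_le_Rmax (g : cube n -> R) : Kset R n g -> Phi g <= Rmax R n.
Proof.
move=> Kg; apply: sup_upper_bound; last by exists g.
have [h Kh hmax] := Phi_max; split; first by exists (Phi h), h.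
by exists (Phi h) => _ [k Kk <-]; exact: hmax.
Qed.

Lemma Rmax_attained : exists2 g, Kset R n g & Phi g = Rmax R n.
Proof.
have [g Kg gmax] := Phi_max; exists g => //.
apply/eqP; rewrite eq_le Phi_le_Rmax//=.
by apply: ge_sup => [|_ [k Kk <-]]; [exists (Phi g), g|exact: gmax].
Qed.

End attained.

(* Main.v *)
(* The functions g in K_n are polynomials of degree at most 2, so that
   E g^4 <= 81 (E g^2)^2 by hypercontractivity. As g >= 0 and E g = 1, the
   fourth moment also dominates (E g^2)^3, whence E g^2 <= 81, and by Parseval
   the squared coefficients of g on pairs sum to at most 80. A fixed pair
   belongs to a proportion 1/(n-1) of the perfect matchings, so bounding the
   squared maximum over a matching by the sum of squares gives
   Phi(g)^2 <= 80/(n-1). *)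
Require Import Defs.
From mathcomp Require Import all_boot all_order all_algebra.
From mathcomp Require Import all_classical all_reals all_analysis.
From mathcomp Require Import perm ring lra.

Import Order.TTheory GRing.Theory Num.Theory.
Local Open Scope ring_scope.

(** * Cauchy-Schwarz and Fourier analysis on the cube *)

Lemma sum_mul_sqr_le (R : realType) (I : finType) (P : pred I) (u v : I -> R) :
  (\sum_(i | P i) u i * v i) ^+ 2
    <= (\sum_(i | P i) u i ^+ 2) * \sum_(i | P i) v i ^+ 2.
Proof.
set U := \sum_(i | P i) u i ^+ 2; set V := \sum_(i | P i) v i ^+ 2.
set W := \sum_(i | P i) u i * v i.
have : 0 <= \sum_(i | P i) \sum_(j | P j) (u i * v j - v i * u j) ^+ 2.
  by do 2!apply: sumr_ge0 => ? _; apply: sqr_ge0.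
suff -> : \sum_(i | P i) \sum_(j | P j) (u i * v j - v i * u j) ^+ 2
          = 2 * (U * V - W ^+ 2) by rewrite pmulr_rge0// subr_ge0.
transitivity (\sum_(i | P i)
    (u i ^+ 2 * V + v i ^+ 2 * U - 2 * (u i * v i) * W)).
  apply: eq_bigr => i _; rewrite /U /V /W !mulr_sumr -sumrN -!big_split /=.
  by apply: eq_bigr => j _; ring.
rewrite sumrB big_split /= -!mulr_suml -mulr_sumr -/U -/V -/W.
by ring.
Qed.

(** The sum over [S] factors as the product over [i] of [1 + x_i y_i] in signs; a factor vanishes
    where [x] and [y] differ. *)
Lemma sum_chi_mul (R : realType) (n : nat) (x y : cube n) :
  \sum_(S : {set 'I_n}) chi R S x * chi R S y = if x == y then 2 ^+ n else 0.
Proof.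
transitivity (\prod_(i < n) ((-1) ^+ x i * (-1) ^+ y i + 1 : R)).
  rewrite bigA_distr; apply: eq_bigr => S _.
  by rewrite /chi -big_split /= big_mkcond.
have [->|] := eqVneq x y.
  rewrite (eq_bigr (fun=> 2)) ?prodr_const ?card_ord// => i _.
  by rewrite -expr2 sqrr_sign.
move=> /eqP /ffunP xy; have [i xyi] : exists i, x i != y i.
  by apply/existsP; apply: contra_notT xy => /existsPn xy i; apply/eqP/negPn.
rewrite (bigD1 i)//=; case: (x i) (y i) xyi => -[]// _;
  by rewrite ?expr0 ?expr1 ?mul1r ?mulr1 addNr mul0r.
Qed.

Lemma fourier_inversion (R : realType) (n : nat) (g : cube n -> R)
    (x : cube n) :
  \sum_(S : {set 'I_n}) fourier g S * chi R S x = g x.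
Proof.
rewrite /fourier; under eq_bigr => S _ do
  rewrite -mulrA mulr_suml mulr_sumr.
rewrite exchange_big /=.
transitivity (\sum_(y : cube n)
    2 ^- n * (g y * (if y == x then 2 ^+ n else 0))).
  apply: eq_bigr => y _; rewrite -sum_chi_mul !mulr_sumr.
  by apply: eq_bigr => S _; rewrite -mulrA.
rewrite (bigD1 x)//= eqxx big1 => [|y /negPf->]; last by rewrite !mulr0.
by rewrite addr0 mulrC mulfK// expf_neq0.
Qed.

Lemma parseval (R : realType) (n : nat) (g : cube n -> R) :
  \sum_(S : {set 'I_n}) fourier g S ^+ 2 = 2 ^- n * \sum_x g x ^+ 2.
Proof.
transitivity (\sum_(S : {set 'I_n}) \sum_(x : cube n)
    2 ^- n * (g x * (fourier g S * chi R S x))).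
  apply: eq_bigr => S _; rewrite expr2 {2}/fourier mulr_sumr mulr_sumr.
  by apply: eq_bigr => x _; ring.
rewrite exchange_big mulr_sumr /=; apply: eq_bigr => x _.
by rewrite -!mulr_sumr fourier_inversion expr2.
Qed.

(** * Hypercontractivity for polynomials of degree at most [k] *)

Definition flip (n : nat) (i : 'I_n) (x : cube n) : cube n :=
  [ffun j => (j == i) (+) x j].

Lemma flipK (n : nat) (i : 'I_n) : involutive (flip n i).
Proof. by move=> x; apply/ffunP => j; rewrite !ffunE addbA addbb. Qed.

Lemma chi_flip (R : realType) (n : nat) (S : {set 'I_n}) (i : 'I_n)
    (x : cube n) :
  i \notin S -> chi R S (flip n i x) = chi R S x.
Proof.
move=> iS; apply: eq_bigr => j jS; rewrite ffunE.
by case: eqP jS iS => [->->|].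
Qed.

(** Substituting [flip n i x] for [x] turns the sum into its opposite. *)
Lemma sum_sign_flip (R : realType) (n : nat) (i : 'I_n) (h : cube n -> R) :
  (forall x, h (flip n i x) = h x) -> \sum_(x : cube n) (-1) ^+ x i * h x = 0.
Proof.
move=> hi; set s := \sum_x _.
suff : s = - s by move=> ?; lra.
rewrite {1}/s (reindex_inj (inv_inj (flipK n i))) /= /s -sumrN.
apply: eq_bigr => x _; rewrite hi ffunE eqxx addTb.
by case: (x i) => /=; rewrite ?expr0 ?expr1; ring.
Qed.

Lemma sum_subset_setU1 (R : realType) (T : finType) (V : {set T}) (i : T)
    (F : {set T} -> R) : i \notin V ->
  \sum_(S : {set T} | S \subset i |: V) F S
    = \sum_(S : {set T} | S \subset V) (F (i |: S)%SET + F S).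
Proof.
move=> iV; rewrite big_split /= (bigID (fun S : {set T} => i \in S)) /=.
congr (_ + _); last first.
  apply: eq_bigl => S; rewrite -subsetD1; congr (S \subset pred_of_set _).
  by rewrite finset.setU1K.
rewrite (reindex_onto (fun S : {set T} => i |: S)%SET (fun S => S :\ i)%SET)/=.
  apply: eq_bigl => S; rewrite finset.setU11 andbT.
  apply/andP/idP => [[sub /eqP SE]|SV].
    rewrite -SE finset.subDset; exact: sub.
  have iS : i \notin S by apply: contra iV => /(fintype.subsetP SV).
  by rewrite finset.setUS// finset.setU1K.
by move=> S /andP[_ iS]; rewrite finset.setD1K.
Qed.

(** Inductive step for [f = x_i d + e]: [A], [X], [B] are the sums of [d^4], [d^2 e^2], [e^4], while
    [D], [E] are those of [d^2], [e^2], with [N = 2^n] and [a = 9^k]. The hypotheses give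
    [N X <= 3 a D E], and [a D^2 + 18 a D E + 9 a E^2 <= 9 a (D + E)^2]; the factor 9 makes the
    cross terms agree. *)
Lemma hypercontractive_step (R : realType) (N a A B X D E : R) :
  0 <= N -> 0 <= a -> 0 <= B -> 0 <= D -> 0 <= E ->
  N * A <= a * D ^+ 2 -> N * B <= 9 * a * E ^+ 2 -> X ^+ 2 <= A * B ->
  N * (A + 6 * X + B) <= 9 * a * (D + E) ^+ 2.
Proof.
move=> N0 a0 B0 D0 E0 hA hB hX.
have aDE : 0 <= a * (D * E) by rewrite !mulr_ge0.
suff hNX : N * X <= 3 * (a * (D * E)).
  have : 0 <= a * D ^+ 2 by rewrite mulr_ge0// sqr_ge0.
  by move=> ?; lra.
apply: le_trans (ler_norm _) _.
rewrite -(ler_pXn2r (ltn0Sn 1)) ?nnegrE ?normr_ge0 ?mulr_ge0//.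
rewrite real_normK ?num_real//.
apply: (@le_trans _ _ ((N * A) * (N * B))).
  have := ler_wpM2l (sqr_ge0 N) hX.
  by rewrite exprMn => /le_trans; apply; lra.
apply: (@le_trans _ _ ((a * D ^+ 2) * (9 * a * E ^+ 2))); last first.
  by lra.
apply: le_trans (ler_wpM2r (mulr_ge0 N0 B0) hA) _.
by apply: ler_wpM2l => //; rewrite mulr_ge0// sqr_ge0.
Qed.

(* Induction on V: for i in V write f = x_i d + e with d, e free of x_i; the odd
   powers of x_i average out in the moments of f. *)
Lemma hypercontractive (R : realType) (n k : nat) (V : {set 'I_n})
    (c : {set 'I_n} -> R) (f : cube n -> R) :
  (forall S : {set 'I_n}, (k < #|S|)%N -> c S = 0) ->
  (forall x, f x = \sum_(S : {set 'I_n} | S \subset V) c S * chi R S x) ->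
  2 ^+ n * \sum_x f x ^+ 4 <= 9 ^+ k * (\sum_x f x ^+ 2) ^+ 2.
Proof.
have [m] := ubnP #|V|; elim: m V k c f => // m IH V k c f Vm c0 fV.
(* Both base cases, [k = 0] and [V] empty, make [f] constant. *)
have const_case a : (forall x, f x = a) ->
    2 ^+ n * \sum_x f x ^+ 4 <= 9 ^+ k * (\sum_x f x ^+ 2) ^+ 2.
  move=> fa; under eq_bigr do rewrite fa; under [in leRHS]eq_bigr do rewrite fa.
  rewrite !sumr_const card_ffun card_bool card_ord -[a ^+ 4 *+ _]mulr_natl.
  rewrite -[a ^+ 2 *+ _]mulr_natl natrX.
  have -> : 2 ^+ n * (2 ^+ n * a ^+ 4) = (2 ^+ n * a ^+ 2) ^+ 2 by ring.
  by rewrite ler_peMl ?sqr_ge0// exprn_ege1// ler1n.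
have chi0 x : \sum_(S : {set 'I_n} | (S \subset V) && (S == finset.set0))
    c S * chi R S x = c finset.set0.
  rewrite (big_pred1 finset.set0) => [|S].
    by rewrite /chi finset.big_set0 mulr1.
  by rewrite /= andbC; case: eqP => //= ->; rewrite finset.sub0set.
case: k c0 const_case => [|k] c0 const_case.
  apply: (const_case (c finset.set0)) => x.
  rewrite fV (bigID (pred1 finset.set0)) /= chi0 big1 ?addr0// => S /andP[_ S0].
  by rewrite c0 ?mul0r// finset.card_gt0.
have [V0|[i iV]] := finset.set_0Vmem V.
  apply: (const_case (c finset.set0)) => x.
  rewrite fV (bigID (pred1 finset.set0)) /= chi0 big1 ?addr0// => S /andP[].
  by rewrite V0 finset.subset0 => ->.
set W := (V :\ i)%SET.
have iW : i \notin W by rewrite finset.setD11.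
have cW : (#|W| < m)%N.
  by move: Vm; rewrite (finset.cardsD1 i) iV.
have VE : V = (i |: W)%SET by rewrite finset.setD1K.
(* The value 0 when [i \in S] leaves [d] unchanged, as [i] is not in [W], but makes its coefficients
   vanish on every [S] with more than [k] elements, as the induction hypothesis demands. *)
pose d (x : cube n) := \sum_(S : {set 'I_n} | S \subset W)
  (if i \in S then 0 else c (i |: S)%SET) * chi R S x.
pose e (x : cube n) := \sum_(S : {set 'I_n} | S \subset W) c S * chi R S x.
have fE x : f x = (-1) ^+ x i * d x + e x.
  rewrite fV VE sum_subset_setU1// big_split /= mulr_sumr; congr (_ + _).
  apply: eq_bigr => S SW.
  have iS : i \notin S by apply: contra iW => /(fintype.subsetP SW).
  by rewrite (negPf iS) /chi finset.big_setU1//=; ring.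
have flipW (b : {set 'I_n} -> R) x :
    \sum_(S : {set 'I_n} | S \subset W) b S * chi R S (flip n i x)
    = \sum_(S : {set 'I_n} | S \subset W) b S * chi R S x.
  apply: eq_bigr => S SW; rewrite chi_flip//.
  by apply: contra iW => /(fintype.subsetP SW).
have dx x : d (flip n i x) = d x by exact: flipW.
have ex x : e (flip n i x) = e x by exact: flipW.
have cross h : (forall x, h (flip n i x) = h x) ->
    forall u, \sum_(x : cube n) (u x + (-1) ^+ x i * h x) = \sum_x u x :> R.
  by move=> hi u; rewrite big_split /= sum_sign_flip// addr0.
have -> : \sum_x f x ^+ 2 = \sum_x d x ^+ 2 + \sum_x e x ^+ 2.
  rewrite -big_split /= -[RHS](cross (fun x => 2 * d x * e x)).
    by apply: eq_bigr => x _; rewrite fE; case: (x i) => /=; ring.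
  by move=> x; rewrite dx ex.
have -> : \sum_x f x ^+ 4
    = \sum_x d x ^+ 4 + 6 * \sum_x d x ^+ 2 * e x ^+ 2 + \sum_x e x ^+ 4.
  rewrite mulr_sumr -!big_split /=.
  rewrite -[RHS](cross (fun x => 4 * d x ^+ 3 * e x + 4 * d x * e x ^+ 3)).
    by apply: eq_bigr => x _; rewrite fE; case: (x i) => /=; ring.
  by move=> x; rewrite dx ex.
rewrite exprS; apply: hypercontractive_step.
- exact: exprn_ge0.
- exact: exprn_ge0.
- by apply: sumr_ge0 => x _; rewrite exprn_even_ge0.
- by apply: sumr_ge0 => x _; rewrite exprn_even_ge0.
- by apply: sumr_ge0 => x _; rewrite exprn_even_ge0.
(* Having lost the factor [x_i], [d] has degree at most [k]; [e] keeps the bound [k.+1]. *)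
- apply: (IH _ _ _ d cW _ (fun=> erefl)) => S kS; case: ifPn => // iS.
  by apply: c0; rewrite finset.cardsU1 iS.
- by rewrite -exprS; apply: (IH _ _ _ e cW c0 (fun=> erefl)).
- have /= := sum_mul_sqr_le R _ xpredT (fun x => d x ^+ 2) (fun x => e x ^+ 2).
  under [X in _ <= X * _]eq_bigr do rewrite -exprM.
  by under [X in _ <= _ * X]eq_bigr do rewrite -exprM.
Qed.

(** * The second moment of a function in [Kset] *)

Lemma Kset_sum_sqr_le (R : realType) (n : nat) (g : cube n -> R) :
  Kset R n g -> \sum_(e : {set 'I_n} | #|e| == 2) fourier g e ^+ 2 <= 80.
Proof.
move=> [g0 g1 gF]; set N : R := 2 ^+ n.
have N0 : 0 < N by rewrite exprn_gt0.
have fF (S : {set 'I_n}) : S != finset.set0 -> #|S| != 2 -> fourier g S = 0.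
  by move=> S0 S2; apply: gF; rewrite inE finset.cards_eq0 S0 S2.
have sum_g : \sum_x g x = N.
  apply: (mulfI (_ : N^-1 != 0)); first by rewrite invr_eq0 gt_eqF.
  rewrite mulVf ?gt_eqF// -[RHS]g1 /fourier; congr (_ * _).
  by apply: eq_bigr => x _; rewrite /chi finset.big_set0 mulr1.
set a := N^-1 * \sum_x g x ^+ 2.
have aE : \sum_x g x ^+ 2 = N * a by rewrite mulrA mulfV ?mul1r// gt_eqF.
have a81 : a <= 81.
  have hyper : N * \sum_x g x ^+ 4 <= 9 ^+ 2 * (N * a) ^+ 2.
    rewrite -aE; apply: (hypercontractive R n 2 finset.setT (fourier g)).
      move=> S S2; apply: fF; last by rewrite gtn_eqF.
      by rewrite -finset.card_gt0 (leq_trans _ S2).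
    move=> x; rewrite -fourier_inversion; apply: eq_bigl => S.
    by rewrite finset.subsetT.
  have a0 : 0 <= a.
    rewrite mulr_ge0 ?invr_ge0 ?(ltW N0)// sumr_ge0// => x _.
    exact: sqr_ge0.
  (* [g^4 - 3 a^2 g^2 + 2 a^3 g = g (g - a)^2 (g + 2 a) >= 0] *)
  have : 0 <= \sum_x (g x ^+ 4 - 3 * a ^+ 2 * g x ^+ 2 + 2 * a ^+ 3 * g x).
    apply: sumr_ge0 => x _.
    have -> : g x ^+ 4 - 3 * a ^+ 2 * g x ^+ 2 + 2 * a ^+ 3 * g x
            = g x * (g x - a) ^+ 2 * (g x + 2 * a) by ring.
    apply: mulr_ge0; first by rewrite mulr_ge0 ?sqr_ge0.
    by rewrite addr_ge0// mulr_ge0.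
  rewrite big_split sumrB /= -!mulr_sumr aE sum_g => ge0.
  (* Averaging the pointwise inequality, with mean of [g] equal to 1 and mean of [g^2] equal to [a],
     bounds the fourth moment below by [3 a^3 - 2 a^3 = a^3]; hypercontractivity bounds it above by
     [81 a^2]. *)
  have : N * (a ^+ 3 * N) <= 81 * N ^+ 2 * a ^+ 2.
    have le4 : a ^+ 3 * N <= \sum_x g x ^+ 4.
      have -> : a ^+ 3 * N = 3 * a ^+ 2 * (N * a) - 2 * a ^+ 3 * N by ring.
      lra.
    apply: le_trans (ler_wpM2l (ltW N0) le4) (le_trans hyper _).
    by lra.
  have [->//|] := eqVneq a 0; rewrite neq_lt ltNge a0 /= => a_gt0.
  have -> : N * (a ^+ 3 * N) = N ^+ 2 * a ^+ 2 * a by ring.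
  have -> : 81 * N ^+ 2 * a ^+ 2 = N ^+ 2 * a ^+ 2 * 81 by ring.
  by rewrite ler_pM2l// mulr_gt0// exprn_gt0.
(* In Parseval's identity the empty set accounts for 1, which leaves [81 - 1 = 80] for the pairs. *)
suff : 1 + \sum_(e : {set 'I_n} | #|e| == 2) fourier g e ^+ 2 <= a.
  by move=> ?; lra.
rewrite /a -parseval [leRHS](bigD1 finset.set0)//= g1 expr1n lerD2l.
rewrite [leRHS](bigID (fun S : {set 'I_n} => #|S| == 2)) /=.
rewrite -[leLHS]addr0 lerD//; last by apply: sumr_ge0 => S _; apply: sqr_ge0.
rewrite le_eqVlt; apply/orP; left; apply/eqP; apply: eq_bigl => S.
by have [->|_] := eqVneq S finset.set0; rewrite ?finset.cards0.
Qed.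

(** * Counting perfect matchings through a given pair *)

Lemma perfect_matchings_imset (n : nat) (s : {perm 'I_n})
    (M : {set {set 'I_n}}) :
  ([set s @: (e : {set 'I_n}) | e in M]%SET \in perfect_matchings n)
    = (M \in perfect_matchings n).
Proof.
rewrite !inE; congr (_ && _).
  rewrite -(imset_partition M finset.setT (@perm_inj _ s)).
  congr finset.partition; apply/setP => x; rewrite !inE; apply/esym/imsetP.
  by exists (s^-1 x)%g; rewrite ?inE ?permKV.
apply/forall_inP/forall_inP => h e eM.
  by rewrite -(card_imset e (@perm_inj _ s)); apply: h; apply: finset.imset_f.
by have /imsetP[f fM ->] := eM; rewrite card_imset ?h//; exact: perm_inj.
Qed.

(** The transposition of [b] and [c] fixes [a], so it injects the matchings containing [{a, b}] into
    those containing [{a, c}], and conversely. *)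
Lemma card_matchings_edge (n : nat) (a b c : 'I_n) : b != a -> c != a ->
  #|[set M in perfect_matchings n | [set a; b]%SET \in M]%SET|
    = #|[set M in perfect_matchings n | [set a; c]%SET \in M]%SET|.
Proof.
suff le (b' c' : 'I_n) : b' != a -> c' != a ->
    (#|[set M in perfect_matchings n | [set a; b']%SET \in M]%SET|
      <= #|[set M in perfect_matchings n | [set a; c']%SET \in M]%SET|)%N.
  by move=> ba ca; apply/eqP; rewrite eqn_leq !le.
move=> ba ca; pose s : {perm 'I_n} := tperm b' c'.
pose act (M : {set {set 'I_n}}) := [set s @: (e : {set 'I_n}) | e in M]%SET.
have act_inj : injective act.
  by apply: imset_inj; apply: imset_inj; exact: perm_inj.
rewrite -(card_imset _ act_inj); apply: subset_leq_card.
apply/fintype.subsetP => _ /imsetP[M + ->]; rewrite inE => /andP[MP abM].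
rewrite inE perfect_matchings_imset MP /=; apply/imsetP.
exists [set a; b']%SET => //.
by rewrite imsetU1 imset_set1 tpermL tpermD.
Qed.

(* Every matching pairs a with exactly one of the n - 1 other points, and by
   symmetry each of these is its partner equally often. *)
Lemma card_matchings_pair (n : nat) (a b : 'I_n) : b != a ->
  (n.-1 * #|[set M in perfect_matchings n | [set a; b]%SET \in M]%SET|)%N
    = #|perfect_matchings n|.
Proof.
move=> ba; rewrite -[n in n.-1]card_ord -(cardC1 a) -sum_nat_const.
(* Double counting of the incidences of a point [c != a] with a matching containing [{a, c}]; summed
   over [c] first, each matching contributes exactly 1. *)
rewrite (eq_bigr (fun c : 'I_n =>
    \sum_(M in perfect_matchings n) ([set a; c]%SET \in M : nat))) => [|c ca].
  rewrite exchange_big -sum1_card; apply: eq_bigr => M.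
  rewrite inE => /andP[Mpart /forall_inP M2] /=.
  have [/eqP covM tivM _] := and3P Mpart.
  have aM : a \in finset.cover M by rewrite covM inE.
  have BM := pblock_mem aM; have := mem_pblock M a; rewrite aM => aB.
  have /cards2P[x [y [xy BE]]] := M2 _ BM.
  have [c ca Bac] : exists2 c, c != a & finset.pblock M a = [set a; c]%SET.
    move: aB; rewrite BE !inE => /orP[]/eqP->.
      by exists y; rewrite // eq_sym.
    by exists x => //; rewrite finset.setUC.
  (* A pair [{a, d}] in [M] is the block of [a], which forces [d = c]. *)
  rewrite (bigD1 c)//= -Bac BM big1 ?addn0// => d /andP[da dc].
  case: (boolP (_ \in M)) => //= adM; move: da; rewrite inE => da.
  have := finset.def_pblock tivM adM (finset.set21 a d).
  by rewrite Bac => /setP/(_ d); rewrite !inE (negPf da) (negPf dc) eqxx.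
rewrite (card_matchings_edge n a b c)// -sum1_card big_mkcond /=.
rewrite [RHS]big_mkcond; apply: eq_bigr => M _.
by rewrite finset.inE; case: (M \in _); case: (_ \in M).
Qed.

Lemma sum_matchings_edges (R : realType) (n : nat) (h : {set 'I_n} -> R) :
  n.-1%:R * \sum_(M in perfect_matchings n) \sum_(e in M) h e
    = #|perfect_matchings n|%:R * \sum_(e : {set 'I_n} | #|e| == 2) h e.
Proof.
rewrite (exchange_big_dep (fun e : {set 'I_n} => #|e| == 2)) /=; last first.
  by move=> M e; rewrite inE => /andP[_ /forall_inP]; apply.
rewrite !mulr_sumr; apply: eq_bigr => e /cards2P[a [b [ab ->]]].
have ba : b != a by rewrite eq_sym.
rewrite -(card_matchings_pair n a b ba) natrM -mulrA; congr (_ * _).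
rewrite sumr_const -[LHS]mulr_natl; congr (_ * _); congr (_%:R).
by apply: eq_card => M; rewrite [RHS]inE.
Qed.

(** * The bound on [Phi] and on [Rmax] *)

(** Cauchy-Schwarz against the constant 1 bounds the square of the average maximum by the average of
    its square, which edge counting then controls. *)
Lemma Phi_sqr_le (R : realType) (n : nat) (g : cube n -> R) :
  (1 < n)%N -> Kset R n g -> Phi g ^+ 2 <= 80 / (n%:R - 1).
Proof.
move=> n1 Kg; set P : R := #|perfect_matchings n|%:R.
have n1R : 0 < n%:R - 1 :> R by rewrite subr_gt0 ltr1n.
have n1E : n.-1%:R = n%:R - 1 :> R.
  by rewrite -[in RHS](prednK (ltnW n1)) -natr1 addrK.
pose m (M : {set {set 'I_n}}) : R := \big[Num.max/0]_(e in M) `|fourier g e|.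
have m_sqr M : m M ^+ 2 <= \sum_(e in M) fourier g e ^+ 2.
  set T := \sum_(e in M) _.
  have T0 : 0 <= T by apply: sumr_ge0 => e _; apply: sqr_ge0.
  have m0 : 0 <= m M.
    by rewrite /m; elim/big_ind: _ => // x y x0 y0; rewrite le_max x0.
  rewrite -(sqr_sqrtr T0) ler_pXn2r ?nnegrE ?sqrtr_ge0//.
  apply: bigmax_le => [|e eM]; first exact: sqrtr_ge0.
  rewrite -sqrtr_sqr ler_wsqrtr// /T (bigD1 e)//= lerDl.
  by apply: sumr_ge0 => ? _; apply: sqr_ge0.
rewrite /Phi -/P; set s := \sum_(M in _) _.
(* Without perfect matchings, as for odd [n], [Phi g] is 0 because division by 0 yields 0. *)
have [P0|P_gt0] := eqVneq P 0.
  by rewrite P0 invr0 mulr0 expr0n /= divr_ge0// ltW.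
have {}P_gt0 : 0 < P by rewrite lt_def P_gt0 ler0n.
have s_sqr : (n%:R - 1) * s ^+ 2 <= P ^+ 2 * 80.
  have := sum_mul_sqr_le R _ (mem (perfect_matchings n)) (fun=> 1) m.
  under eq_bigr do rewrite mul1r.
  under [X in _ <= X * _]eq_bigr do rewrite expr1n.
  rewrite sumr_const -/P => /(ler_wpM2l (ltW n1R))/le_trans; apply.
  rewrite mulrCA expr2 -mulrA; apply: ler_wpM2l; first exact: ltW.
  apply: (@le_trans _ _ (P * \sum_(e : {set 'I_n} | #|e| == 2)
      fourier g e ^+ 2)).
    rewrite -sum_matchings_edges n1E; apply: ler_wpM2l; first exact: ltW.
    exact: ler_sum.
  by apply: ler_wpM2l; [exact: ltW|exact: Kset_sum_sqr_le].
rewrite expr_div_n ler_pdivrMr ?exprn_gt0// mulrAC ler_pdivlMr//.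
by rewrite mulrC (mulrC 80).
Qed.

Theorem proposition3 (R : realType) (n : nat) (n_gt0 : (0 < n)%N)
    (n_even : ~~ odd n) :
  Rmax R n <= 2 * Num.sqrt (80 / (n%:R - 1) : R) < 18 / Num.sqrt (n%:R - 1 : R).
Proof.
have n1 : (1 < n)%N by case: n n_gt0 n_even => [|[|]].
have n1R : 0 < n%:R - 1 :> R by rewrite subr_gt0 ltr1n.
apply/andP; split.
  have [g Kg <-] := Rmax_attained R n.
  (* This is stronger than the claim by a factor 2. *)
  have : Phi g <= Num.sqrt (80 / (n%:R - 1)).
    apply: le_trans (ler_norm _) _; rewrite -sqrtr_sqr ler_wsqrtr//.
    exact: Phi_sqr_le.
  by have := sqrtr_ge0 (80 / (n%:R - 1) : R); lra.
rewrite sqrtrM// sqrtrV ?(ltW n1R)// mulrA ltr_pM2r ?invr_gt0 ?sqrtr_gt0//.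
(* After cancelling the common factor and squaring, the claim is [80 < (18 / 2)^2 = 81]. *)
rewrite mulrC -ltr_pdivlMr// -[ltRHS]ger0_norm// -sqrtr_sqr ltr_sqrt.
  lra.
by rewrite exprn_gt0.
Qed.
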